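(* Let $R$ be a commutative ring with non-zero identity that is not a quasilocal ring, and let $M$ be a non-zero unital $R$-module. Then a proper submodule $N$ of $M$ is a 1-absorbing prime submodule of $M$ if and only if $N$ is a prime submodule of $M$.
   Context: A ring is quasilocal if it has exactly one maximal ideal. For a submodule $N$ of $M$, $(N:M)=\{r\in R: rM\subseteq N\}$. A proper submodule $N$ of $M$ is prime if for all $r\in R$, $m\in M$, $rm\in N$ implies $m\in N$ or $rM\subseteq N$. A proper submodule $N$ of $M$ is 1-absorbing prime if for all non-unit elements $a,b\in R$ and all $m\in M$, $abm\in N$ implies $ab\in(N:M)$ or $m\in N$. *)

(* Defs.v *)
From HB Require Import structures.
From mathcomp Require Import all_boot all_order all_algebra.
From mathcomp Require Import boolp classical_sets.

Set Implicit Arguments.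
Unset Strict Implicit.
Unset Printing Implicit Defensive.

Import GRing.Theory.
Local Open Scope classical_set_scope.
Local Open Scope ring_scope.

(** Ideals and submodules are arbitrary [Prop]-valued subsets; classically, [mem]
    turns them into the boolean predicates that the closure conditions expect. *)

(** Invertibility is stated existentially because a [comNzRingType] carries no
    [GRing.unit] predicate. *)
Definition invertible (R : comNzRingType) (a : R) : Prop :=
  exists b : R, a * b = 1.

(** [idealr_closed] already requires properness ([1 \notin I]). *)
Definition maximal_ideal (R : comNzRingType) (I : set R) : Prop :=
  idealr_closed (mem I) /\
  forall J : set R, idealr_closed (mem J) -> I `<=` J -> J = I.

Definition quasilocal (R : comNzRingType) : Prop :=
  exists! I : set R, maximal_ideal I.

Definition proper_submodule (R : comNzRingType) (M : lmodType R) (N : set M)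
  : Prop :=
  GRing.submod_closed (mem N) /\ N <> [set: M].

(** The residual (N : M). *)
Definition residual (R : comNzRingType) (M : lmodType R) (N : set M) : set R :=
  [set r : R | [set r *: m | m in [set: M]] `<=` N].

Definition prime_submodule (R : comNzRingType) (M : lmodType R) (N : set M)
  : Prop :=
  proper_submodule N /\
  forall (r : R) (m : M), N (r *: m) ->
    N m \/ [set r *: m' | m' in [set: M]] `<=` N.

Definition one_absorbing_prime_submodule (R : comNzRingType) (M : lmodType R)
  (N : set M) : Prop :=
  proper_submodule N /\
  forall (a b : R) (m : M), ~ invertible a -> ~ invertible b ->
    N ((a * b) *: m) -> residual N (a * b) \/ N m.

(* Main.v *)
(** If [r *: m] lies in a 1-absorbing prime [N] and [m] does not, then [a * r]
    is in the residual of [N] for every non-unit [a].  A ring in which the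
    non-units are closed under addition is quasilocal, the non-units forming
    its only maximal ideal; so here there are non-units with sum [1], and
    adding up puts [r] in the residual. *)
Require Import Defs.
From mathcomp Require Import all_boot all_order all_algebra.
From mathcomp Require Import boolp classical_sets.

Import GRing.Theory.

Local Open Scope ring_scope.

Lemma invertible_mull (R : comNzRingType) (a b : R) :
  invertible (a * b) -> invertible b.
Proof. by move=> [c abc]; exists (a * c); rewrite mulrCA mulrA. Qed.

Lemma proper_ideal_noninvertible (R : comNzRingType) (J : set R) (x : R) :
  idealr_closed (mem J) -> J x -> ~ invertible x.
Proof.
move=> [J0 J1 JD] /mem_set Jx [y xy]; move/negP: J1; apply.
by rewrite -xy mulrC -[y * x]addr0; apply: JD.
Qed.

(** A proper ideal contains no unit, so the ideal of all non-units contains every proper ideal. *)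
Lemma noninvertible_addr_closed_quasilocal (R : comNzRingType) :
  (forall a b : R, ~ invertible a -> ~ invertible b -> ~ invertible (a + b)) ->
  quasilocal R.
Proof.
move=> nuD; pose I : set R := [set a | ~ invertible a]%classic.
have Iideal : idealr_closed (mem I).
  split.
  - by apply: mem_set => -[b]; rewrite mul0r => /esym/eqP; rewrite oner_eq0.
  - by apply/negP => /set_mem; apply; exists 1; rewrite mulr1.
  - move=> a u v /set_mem nu /set_mem nv; apply: mem_set; apply: nuD => //.
    by move=> /invertible_mull.
exists I; split=> [|J [Jideal Jmax]].
  split=> // J Jideal IJ; apply/seteqP; split=> // x.
  exact: proper_ideal_noninvertible.
by apply: Jmax => // x; apply: proper_ideal_noninvertible.
Qed.

Lemma not_quasilocal_noninvertible_sum1 (R : comNzRingType) :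
  ~ quasilocal R ->
  exists a b : R, [/\ ~ invertible a, ~ invertible b & a + b = 1].
Proof.
move=> nql; apply: contrapT => nex; apply: nql.
apply: noninvertible_addr_closed_quasilocal => a b na nb [c abc]; apply: nex.
(* Scaling by the inverse [c] of [a + b] makes the sum [1]; both terms stay non-units, as a factor
   of a unit is a unit. *)
exists (c * a), (c * b); split; [by move/invertible_mull|by move/invertible_mull|].
by rewrite -mulrDr mulrC.
Qed.

Theorem corollary1 (R : comNzRingType) (M : lmodType R)
    (hR : ~ quasilocal R) (hM : exists x : M, x <> 0)
    (N : set M) (hN : proper_submodule N) :
  one_absorbing_prime_submodule N <-> prime_submodule N.
Proof.
split=> [[_ N1abs]|[_ Nprime]]; split=> //; last first.
  (* Primeness is applied to [a * b] as a single scalar. *)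
  by move=> a b m _ _ /Nprime[]; [right|left].
move=> r m Nrm.
have [[_ NZD] _] := hN.
have NZ a x : N x -> N (a *: x).
  by move=> /mem_set Nx; apply: set_mem; rewrite -[a *: x]addr0; apply: NZD;
    rewrite // (hN.1.1).
have ND x y : N x -> N y -> N (x + y).
  by move=> /mem_set Nx /mem_set Ny; apply: set_mem; rewrite -[x]scale1r; apply: NZD.
have [Nm|nNm] := pselect (N m); [by left|right].
(* An inverse of [r] would carry [r *: m] back to [m] inside [N]. *)
have nr : ~ invertible r.
  by move=> [s rs]; apply: nNm; rewrite -[m]scale1r -rs mulrC -scalerA; apply: NZ.
have Nar a : ~ invertible a -> residual N (a * r).
  by move=> na; case: (N1abs a r m na nr) => //; rewrite -scalerA; apply: NZ.
have [a [b [na nb ab1]]] := @not_quasilocal_noninvertible_sum1 R hR.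
(* Split [r] as [a * r + b * r], both terms in the residual by [Nar]. *)
move=> _ [m' _ <-]; rewrite -[r]mul1r -ab1 mulrDl scalerDl.
by apply: ND; [apply: (Nar a na)|apply: (Nar b nb)]; exists m'.
Qed.
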